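(* Let $X$ be a nonempty proper metric space. Suppose that $f\colon X\to X$ is an isometry map (distance-preserving map) and that $\overline{X}$ is a coarse compactification of $X$ such that $f$ extends to a continuous map $\bar f\colon\overline{X}\to\overline{X}$. If $f$ does not have any coarse fixed point in $X$, then $\bar f$ has a fixed point in $\partial X=\overline{X}\setminus X$.
   Context: A metric space is proper if its closed bounded subsets are compact. It carries the bounded coarse structure: $E\subset X\times X$ is controlled if $\sup_{(x,y)\in E}d(x,y)<\infty$. A point $x\in X$ is a coarse fixed point of $f$ if its orbit $\{f^n(x): n\in\mathbb{N}\}$ is a bounded set. A compactification $\overline{X}$ of $X$ (compact Hausdorff, containing $X$ as an open dense subspace) is a coarse compactification if for every controlled set $E\subset X\times X$ the closure $\overline{E}$ in $\overline{X}\times\overline{X}$ satisfies $\overline{E}\cap\big((\overline{X}\times\overline{X})\setminus(X\times X)\big)\subset\{(\omega,\omega):\omega\in\partial X\}$, where $\partial X=\overline{X}\setminus X$. *)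

(* Defs.v *)
From HB Require Import structures.
From mathcomp Require Import all_boot all_order all_algebra.
From mathcomp Require Import all_classical all_reals all_analysis.

Set Implicit Arguments.
Unset Strict Implicit.
Unset Printing Implicit Defensive.

Import Order.TTheory GRing.Theory Num.Theory.

Local Open Scope classical_set_scope.
Local Open Scope ring_scope.

Section Metric.
Context {R : realType} {X : metricType R}.

(* The library's [bounded_set] is only available on normed spaces. *)
Definition metric_bounded (A : set X) : Prop :=
  exists r : R, forall x y, A x -> A y -> mdist x y <= r.

Definition proper_metric : Prop :=
  forall A : set X, closed A -> metric_bounded A -> compact A.

(* The supremum is taken in [\bar R], so the empty set is controlled. *)
Definition controlled (E : set (X * X)) : Prop :=
  (ereal_sup [set (mdist p.1 p.2)%:E | p in E] < +oo)%E.

Definition isometry_map (f : X -> X) : Prop :=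
  forall x y, mdist (f x) (f y) = mdist x y.

Definition coarse_fixed_point (f : X -> X) (x : X) : Prop :=
  metric_bounded [set iter n f x | n in [set: nat]].

End Metric.

Arguments proper_metric {R} X.

(* A compactification of X is a space Y with a map [i : X -> Y] identifying X
   with the subspace [range i] of Y. *)
Section Compactification.
Context {X Y : topologicalType} (i : X -> Y).

Definition boundary : set Y := ~` range i.

Record compactification : Prop := Compactification {
  compactification_compact : compact [set: Y] ;
  compactification_hausdorff : hausdorff_space Y ;
  compactification_inj : injective i ;
  (* X carries the subspace topology *)
  compactification_open : forall A : set X,
    open A <-> exists2 B : set Y, open B & i @^-1` B = A ;
  compactification_open_range : open (range i) ;
  compactification_dense_range : dense (range i)
}.

End Compactification.

Definition coarse_compactification (R : realType) (X : metricType R)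
    (Y : topologicalType) (i : X -> Y) : Prop :=
  compactification i /\
  forall E : set (X * X), controlled E ->
    closure [set (i p.1, i p.2) | p in E] `&` ~` (range i `*` range i)
      `<=` [set (w, w) | w in boundary i].

(* Main.v *)
(* The orbit of x has a cluster point w in the boundary: otherwise its closure
   is a compact set inside X, hence bounded. The set of pairs (f^n x, f^(n+1) x)
   is controlled because f is an isometry, and (w, fbar w) lies in its closure,
   so coarseness of the compactification forces fbar w = w. *)
Require Import Defs.
From HB Require Import structures.
From mathcomp Require Import all_boot all_order all_algebra.
From mathcomp Require Import all_classical all_reals all_analysis.

Set Implicit Arguments.
Unset Strict Implicit.
Unset Printing Implicit Defensive.

Import Order.TTheory GRing.Theory Num.Theory.

Local Open Scope classical_set_scope.
Local Open Scope ring_scope.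

(** Each point of [K] has a neighbourhood in [Y] on whose preimage the distance to a base point [x0]
    is bounded; compactness, in its near-covering form, makes the bound uniform over [K]. *)
Lemma compact_preimage_bounded (R : realType) (X : metricType R)
    (Y : topologicalType) (i : X -> Y)
    (i_open : forall A : set X, open A -> exists2 B : set Y, open B & i @^-1` B = A)
    (K : set Y) :
  compact K -> K `<=` range i -> metric_bounded (i @^-1` K).
Proof.
move=> /compact_near_coveringP Kcpt Ki.
have [[x0]|X0] := pselect (exists x : X, True); last first.
  by exists 0 => x; case: X0; exists x.
(* Quantifying over all [z] above [y] avoids inverting [i]; off [range i] the condition is
   vacuous. *)
pose P (n : nat) y := forall z, i z = y -> mdist x0 z <= n%:R.
have /(Kcpt _ _ P) : forall y, K y -> \forall y' \near y & n \near \oo, P n y'.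
  move=> y /Ki[z _ <-].
  (* [B] traces on [X] the interior of the unit ball at [z], hence the local bound
     [mdist x0 z + 1]. *)
  have [B oB iB] := i_open _ (@open_interior _ (ball z 1)).
  have Bz : nbhs (i z) B.
    apply: open_nbhs_nbhs; split => //.
    suff : (i @^-1` B) z by [].
    by rewrite iB; exact: nbhsx_ballx.
  exists (B, [set n : nat | mdist x0 z + 1 <= n%:R]).
    by split => //; exact: nbhs_infty_ger.
  move=> [y' n] /= [By' le_n] z' iz'.
  have : (i @^-1` B) z' by rewrite /= iz'.
  rewrite iB => /interior_subset; rewrite ballEmdist /= => /ltW zz'.
  apply: le_trans le_n; apply: le_trans (metric_triangle _ z _) _.
  by rewrite lerD2l.
move=> [n _ /(_ _ (leqnn n)) KP].
exists (n%:R + n%:R) => x y Kx Ky.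
apply: le_trans (metric_triangle _ x0 _) _.
by rewrite lerD ?[mdist x _]metric_sym; [| exact: KP Kx _ _ | exact: KP Ky _ _].
Qed.

Theorem corollary1p7 (R : realType) (X : metricType R)
  (X_nonempty : [set: X] !=set0) (X_proper : proper_metric X)
  (f : X -> X) (f_isometry : isometry_map f)
  (Xbar : topologicalType) (i : X -> Xbar)
  (i_coarse : coarse_compactification i)
  (fbar : Xbar -> Xbar) (fbar_continuous : continuous fbar)
  (fbar_extends : forall x : X, fbar (i x) = i (f x))
  (no_coarse_fixed_point : ~ exists x : X, coarse_fixed_point f x) :
  exists2 w : Xbar, boundary i w & fbar w = w.
Proof.
have [x _] := X_nonempty.
have [[Ycpt _ _ i_open _ _] i_coarse_closure] := i_coarse.
pose orbit := [set iter n f x | n in [set: nat]].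
have [w clw wi] : exists2 w, closure (i @` orbit) w & boundary i w.
  apply: contrapT => no_w; apply: no_coarse_fixed_point; exists x.
  have [r Kr] : metric_bounded (i @^-1` closure (i @` orbit)).
    apply: compact_preimage_bounded => [A /i_open //||w clw].
      exact: subclosed_compact (@closed_closure _ _) Ycpt _.
    by apply: contrapT => wi; apply: no_w; exists w.
  by exists r => y z oy oz; apply: Kr; apply: subset_closure; [exists y|exists z].
exists w => //.
pose E := [set (y, f y) | y in orbit].
have Ectrl : controlled E.
  (* By induction on [n], every pair in [E] is exactly [mdist x (f x)] apart. *)
  apply: (@le_lt_trans _ _ (mdist x (f x))%:E); last exact: ltry.
  apply: ge_ereal_sup => _ [_ [_ [n _ <-] <-] <-] /=.
  by rewrite lee_fin; elim: n => // n; rewrite /= f_isometry.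
have clE : closure [set (i p.1, i p.2) | p in E] (w, fbar w).
  move=> W [[U V] /= [Uw Vw] UV].
  (* By continuity [U] meets the preimage of [V] under [fbar] in a neighbourhood of [w], so a single
     orbit point serves both coordinates. *)
  have [_ [[y oy <-] [Uy Vy]]] := clw _ (filterI Uw (fbar_continuous w _ Vw)).
  exists (i y, i (f y)); split; first by exists (y, f y) => //; exists y.
  by apply: UV; split => //=; rewrite -fbar_extends.
(* The pair lies outside [range i] squared because its first coordinate [w] does. *)
have [|v _ [<- <-] //] := i_coarse_closure E Ectrl (w, fbar w).
by split => // -[].
Qed.
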